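(* Let $G$ be a Lie group, $H$ a closed subgroup of $G$, and $\mathfrak{a}$ an $\mathbb{F}$-algebra that is also a representation of $H$ such that $h(aa_1)=(ha)(ha_1)$ for all $h\in H$ and $a,a_1\in\mathfrak{a}$. (a) The automorphic algebra $\mathfrak{A}(G,H,\mathfrak{a})$ is precisely the algebra of constant maps $G\to\mathfrak{a}^H$. (b) If $G$ acts on $\mathfrak{a}$ by algebra isomorphisms (the $H$-action on $\mathfrak{a}$ being the restriction of this $G$-action), then the algebra $\mathfrak{M}_G(G/H,\mathfrak{a})$ of $G$-equivariant maps $G/H\to\mathfrak{a}$ is precisely the algebra of maps $gH\mapsto ga$ where $a\in\mathfrak{a}^H$. This provides isomorphisms of algebras $\mathfrak{A}(G,H,\mathfrak{a})\cong\mathfrak{M}_G(G/H,\mathfrak{a})\cong\mathfrak{a}^H$ (where the middle algebra is defined in the situation of (b)).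
   Context: $\mathbb{F}$ is $\mathbb{R}$ or $\mathbb{C}$. An algebra is a vector space with a bilinear product (e.g. associative or Lie). $\mathfrak{a}^H=\{a\in\mathfrak{a}\mid ha=a\ \forall h\in H\}$. $\mathfrak{M}(G,H,\mathfrak{a})=\{f:G\to\mathfrak{a}\mid f(gh)=h^{-1}f(g)\ \forall h\in H,\ \forall g\in G\}$, with pointwise product $(ff_1)(g)=f(g)f_1(g)$ and $G$-action $(g_1\cdot f)(g)=f(g_1^{-1}g)$. (These maps are the sections of the homogeneous bundle $G\times_H\mathfrak{a}$ over $G/H$.) The automorphic algebra is the subalgebra of invariants $\mathfrak{A}(G,H,\mathfrak{a})=\mathfrak{M}(G,H,\mathfrak{a})^G$. When $G$ acts on $\mathfrak{a}$ by algebra isomorphisms, $\mathfrak{M}_G(G/H,\mathfrak{a})=\{K:G/H\to\mathfrak{a}\mid K(gx)=gK(x)\ \forall g\in G,\ x\in G/H\}$ with pointwise product. No continuity or smoothness condition is imposed on any of these maps. *)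

(* Defs.v *)
From HB Require Import structures.
From mathcomp Require Import all_boot all_order all_algebra.
From mathcomp Require Import sesquilinear generic_quotient complex.
From mathcomp Require Import all_classical all_reals all_analysis.

Set Implicit Arguments.
Unset Strict Implicit.
Unset Printing Implicit Defensive.

Import Order.TTheory GRing.Theory Num.Theory.
Import numFieldNormedType.Exports.

Local Open Scope classical_set_scope.
Local Open Scope ring_scope.
Local Open Scope quotient_scope.

Variant scalars := Real | Complex.

Definition scalar_field (R : realType) (k : scalars) : fieldType :=
  match k with Real => R | Complex => complex R end.

(* Not necessarily associative, commutative or unital algebras. *)
HB.mixin Record Lmodule_hasBilinearProduct (F : nzRingType) A
    of GRing.Lmodule F A := {
  amul : A -> A -> A ;
  amul_bilinear : bilinear_for *:%R *:%R amul
}.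

#[short(type="nonassocAlgType")]
HB.structure Definition NonassocAlgebra (F : nzRingType) :=
  {A of Lmodule_hasBilinearProduct F A & GRing.Lmodule F A}.

Section PointwiseAlgebra.
Variables (T : Type) (F : nzRingType) (A : nonassocAlgType F).

Definition fct_amul (f g : T -> A) : T -> A := fun x => amul (f x) (g x).

Lemma fct_amul_bilinear : bilinear_for *:%R *:%R fct_amul.
Proof.
by split=> g c f1 f2; apply/funext => x; rewrite /fct_amul !fctE;
  [exact: amul_bilinear.1 | exact: amul_bilinear.2].
Qed.

HB.instance Definition _ :=
  Lmodule_hasBilinearProduct.Build F (T -> A) fct_amul_bilinear.

End PointwiseAlgebra.

Section Subalgebras.
Variables (F : nzRingType).

Definition subalgebra (A : nonassocAlgType F) (S : set A) : Prop :=
  [/\ S 0,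
      forall (c : F) x y, S x -> S y -> S (c *: x + y)
    & forall x y, S x -> S y -> S (amul x y)].

(* Only the values of [f] on [S] matter. *)
Definition algebra_isomorphism (A B : nonassocAlgType F) (S : set A)
    (T : set B) (f : A -> B) : Prop :=
  [/\ subalgebra S /\ subalgebra T,
      set_bij S T f,
      forall (c : F) x y, S x -> S y -> f (c *: x + y) = c *: f x + f y
    & forall x y, S x -> S y -> f (amul x y) = amul (f x) (f y)].

End Subalgebras.

Section Smoothness.
Variables (R : realType) (V W : normedModType R).

Fixpoint continuously_differentiable (n : nat) (U : set V) (f : V -> W) : Prop :=
  match n with
  | 0 => forall x, U x -> {for x, continuous f}
  | m.+1 => (forall x, U x -> differentiable f x) /\
            forall v, continuously_differentiable m U (fun x => 'D_v f x)
  end.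

(* Meaningful when [U] is open; the values of [f] outside [U] are irrelevant. *)
Definition smooth_on (U : set V) (f : V -> W) : Prop :=
  forall n, continuously_differentiable n U f.

End Smoothness.

(* A homeomorphism from an open subset of [T] onto an open subset of [V]; both
   maps are totalized, with arbitrary values outside these open sets. *)
Record chart (R : realType) (T : topologicalType) (V : normedModType R) := Chart {
  chart_dom : set T ;
  chart_cod : set V ;
  chart_fun :> T -> V ;
  chart_inv : V -> T ;
  chart_dom_open : open chart_dom ;
  chart_cod_open : open chart_cod ;
  chart_funS : forall x, chart_dom x -> chart_cod (chart_fun x) ;
  chart_invS : forall v, chart_cod v -> chart_dom (chart_inv v) ;
  chart_funK : forall x, chart_dom x -> chart_inv (chart_fun x) = x ;
  chart_invK : forall v, chart_cod v -> chart_fun (chart_inv v) = v ;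
  chart_fun_continuous : forall x, chart_dom x -> {for x, continuous chart_fun} ;
  chart_inv_continuous : forall v, chart_cod v -> {for v, continuous chart_inv}
}.

#[short(type="preTopologicalGroupType")]
HB.structure Definition PreTopologicalGroup := {G of Group G & Topological G}.

(* Finite-dimensional real Lie groups. A single dimension suffices since
   translations make a Lie group homogeneous; dimension 0 is allowed. *)
HB.mixin Record isLieGroup (R : realType) G of PreTopologicalGroup G := {
  lie_hausdorff : hausdorff_space G ;
  lie_second_countable : @second_countable G ;
  lie_mul_continuous : continuous (fun p : G * G => (p.1 * p.2)%g) ;
  lie_inv_continuous : continuous (fun x : G => (x^-1)%g) ;
  lie_dim : nat ;
  lie_atlas : set (chart G 'rV[R]_lie_dim) ;
  lie_atlas_cover : forall x : G, exists2 c, lie_atlas c & chart_dom c x ;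
  lie_atlas_compatible : forall c1 c2, lie_atlas c1 -> lie_atlas c2 ->
    smooth_on [set u | chart_cod c1 u /\ chart_dom c2 (chart_inv c1 u)]
              (fun u => c2 (chart_inv c1 u)) ;
  lie_mul_smooth : forall c1 c2 c3,
    lie_atlas c1 -> lie_atlas c2 -> lie_atlas c3 ->
    smooth_on
      [set p : 'rV[R]_lie_dim * 'rV[R]_lie_dim |
        [/\ chart_cod c1 p.1, chart_cod c2 p.2
          & chart_dom c3 (chart_inv c1 p.1 * chart_inv c2 p.2)%g]]
      (fun p => c3 (chart_inv c1 p.1 * chart_inv c2 p.2)%g) ;
  lie_inv_smooth : forall c1 c2, lie_atlas c1 -> lie_atlas c2 ->
    smooth_on [set u | chart_cod c1 u /\ chart_dom c2 ((chart_inv c1 u)^-1)%g]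
              (fun u => c2 ((chart_inv c1 u)^-1)%g)
}.

#[short(type="lieGroupType")]
HB.structure Definition LieGroup (R : realType) :=
  {G of isLieGroup R G & PreTopologicalGroup G}.

Section Subgroups.
Variables (G : groupType) (H : groupClosed G).

Definition subgroup_type : Type := {x : G | x \in H}.

HB.instance Definition _ := SubType.on subgroup_type.
HB.instance Definition _ := [Choice of subgroup_type by <:].

Lemma subgroup_group_closed : group_closed (mem H).
Proof.
by split; [exact: gpred1 | move=> x y xH yH; rewrite gpredM// gpredVr].
Qed.

HB.instance Definition _ := SubChoice_isSubGroup.Build G (fun x => x \in H)
  subgroup_type subgroup_group_closed.

(* [x] and [y] are equivalent iff [xH = yH]. *)
Definition left_coset_rel (x y : G) : bool := (x^-1 * y)%g \in H.

Lemma left_coset_rel_refl : reflexive left_coset_rel.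
Proof. by move=> x; rewrite /left_coset_rel mulVg gpred1. Qed.

Lemma left_coset_rel_sym : symmetric left_coset_rel.
Proof. by move=> x y; rewrite /left_coset_rel -gpredV invgM invgK. Qed.

Lemma left_coset_rel_trans : transitive left_coset_rel.
Proof.
move=> y x z; rewrite /left_coset_rel => xy yz.
have -> : (x^-1 * z = (x^-1 * y) * (y^-1 * z))%g by rewrite -mulgA mulVKg.
exact: gpredM.
Qed.

Canonical left_coset_equiv :=
  EquivRel left_coset_rel left_coset_rel_refl left_coset_rel_sym
    left_coset_rel_trans.

Definition coset_space := {eq_quot left_coset_rel}.

Definition coset (g : G) : coset_space := \pi_coset_space g.

Definition coset_translate (g : G) (x : coset_space) : coset_space :=
  coset (g * repr x)%g.

(* Hence the choice of representatives in [coset_translate] is immaterial. *)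
Lemma coset_translateE g g1 : coset_translate g (coset g1) = coset (g * g1)%g.
Proof.
apply/eqmodP; rewrite /= /left_coset_rel invgM -mulgA mulKg.
by rewrite -/(left_coset_rel _ _); apply/eqmodP; rewrite reprK.
Qed.

End Subgroups.

Arguments coset {G} H g.

Definition fixed_points (K : Type) (X : Type) (act : K -> X -> X) : set X :=
  [set x | forall k, act k x = x].

(* A linear representation of [K] on [A], of arbitrary dimension and without
   continuity condition, acting by automorphisms of the algebra [A]. *)
Definition algebra_representation (F : nzRingType) (K : groupType)
    (A : nonassocAlgType F) (act : K -> A -> A) : Prop :=
  [/\ forall a, act 1%g a = a,
      forall k l a, act (k * l)%g a = act k (act l a),
      forall k (c : F) a b, act k (c *: a + b) = c *: act k a + act k b
    & forall k a b, act k (amul a b) = amul (act k a) (act k b)].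

Section AutomorphicAlgebra.
Variables (F : nzRingType) (G : groupType) (H : groupClosed G).
Variables (A : nonassocAlgType F).

Definition bundle_sections (rho : subgroup_type H -> A -> A) : set (G -> A) :=
  [set f | forall (h : subgroup_type H) g, f (g * \val h)%g = rho h^-1%g (f g)].

Definition left_translate (g1 : G) (f : G -> A) : G -> A :=
  fun g => f (g1^-1 * g)%g.

Definition automorphic_algebra (rho : subgroup_type H -> A -> A) : set (G -> A) :=
  bundle_sections rho `&` fixed_points left_translate.

Definition equivariant_maps (sigma : G -> A -> A) : set (coset_space H -> A) :=
  [set K | forall g x, K (coset_translate g x) = sigma g (K x)].

End AutomorphicAlgebra.

Arguments equivariant_maps {F G} H {A} sigma.

(* Main.v *)
(** Left-invariant maps on [G] are constant since [G] acts transitively on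
itself, and the value [a] of a constant map satisfies the section condition iff
[H] fixes it. An equivariant map on [G/H] is determined by its value [a] at the
base point, which is [H]-fixed because [H] stabilizes the base point;
conversely [gH |-> ga] is well defined when [a] is [H]-fixed. *)

Require Import Defs.
From HB Require Import structures.
From mathcomp Require Import all_boot all_order all_algebra.
From mathcomp Require Import generic_quotient.
From mathcomp Require Import all_classical all_reals all_analysis.

Set Implicit Arguments.
Unset Strict Implicit.
Unset Printing Implicit Defensive.

Import GRing.Theory.

Local Open Scope classical_set_scope.
Local Open Scope ring_scope.

Section Subalgebras.
Variables (F : nzRingType) (A B : nonassocAlgType F).

(** Surjectivity and the closure properties of the target come for free on an image, so each
    isomorphism below reduces to writing its target as the image of a subalgebra and checking
    injectivity. *)
Lemma algebra_isomorphism_image (S : set A) (f : A -> B) :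
  subalgebra S -> set_inj S f ->
  (forall (c : F) x y, S x -> S y -> f (c *: x + y) = c *: f x + f y) ->
  (forall x y, S x -> S y -> f (amul x y) = amul (f x) (f y)) ->
  algebra_isomorphism S (f @` S) f.
Proof.
move=> subS injf flin fmul; have [S0 Slin Smul] := subS.
split=> //; last by split=> //; exact: image_subset.
split=> //; split=> [|c _ _ [x Sx <-] [y Sy <-]|_ _ [x Sx <-] [y Sy <-]].
(* With [c = -1] and [x = y = 0], linearity reads [f 0 = - f 0 + f 0], so [f 0 = 0]. *)
- exists 0 => //; have := flin (-1) 0 0 S0 S0.
  by rewrite scaler0 addr0 scaleN1r addNr.
- by exists (c *: x + y); [exact: Slin | exact: flin].
- by exists (amul x y); [exact: Smul | exact: fmul].
Qed.

Lemma fixed_points_subalgebra (K : groupType) (act : K -> A -> A) :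
  algebra_representation act -> subalgebra (fixed_points act).
Proof.
move=> [_ _ lin mul]; split=> [k|c x y Sx Sy k|x y Sx Sy k].
- by have := lin k (-1) 0 0; rewrite scaler0 addr0 scaleN1r addNr.
- by rewrite lin Sx Sy.
- by rewrite mul Sx Sy.
Qed.

End Subalgebras.

Section AutomorphicAlgebra.
Variables (F : nzRingType) (G : groupType) (H : groupClosed G).
Variables (A : nonassocAlgType F) (rho : subgroup_type H -> A -> A).
Hypothesis rho_rep : algebra_representation rho.

Lemma left_invariant_cst (f : G -> A) :
  fixed_points (@left_translate F G A) f -> f = cst (f 1%g).
Proof.
move=> f_inv; apply/funext => g.
(* Translating by [g] itself moves the evaluation point from [g] to [1]. *)
by rewrite -[in LHS](f_inv g) /left_translate mulVg.
Qed.

Lemma automorphic_algebraE :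
  automorphic_algebra rho = [set cst a | a in fixed_points rho].
Proof.
apply/seteqP; split=> [f [f_sec f_inv]|_ [a a_fix <-]].
- have fE := left_invariant_cst f_inv; exists (f 1%g) => // h.
  (* The section condition acts through the inverse, so it is used at [h^-1] to obtain [rho h]. *)
  by have := f_sec h^-1%g 1%g; rewrite invgK fE.
- by split=> [h g|g]; [rewrite /= a_fix | apply/funext].
Qed.

Lemma cst_isomorphism :
  algebra_isomorphism (fixed_points rho) (automorphic_algebra rho)
    (fun a => cst a).
Proof.
rewrite automorphic_algebraE; apply: algebra_isomorphism_image => //.
- exact: fixed_points_subalgebra.
- by move=> x y _ _ /(congr1 (@^~ 1%g)).
Qed.

Section EquivariantMaps.
Variable sigma : G -> A -> A.
Hypothesis sigma_rep : algebra_representation sigma.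
Hypothesis rhoE : forall h a, rho h a = sigma (\val h) a.

Lemma coset_repr (x : coset_space H) : coset H (repr x) = x.
Proof. exact: reprK. Qed.

(** Choosing a representative makes the map total in [a]. Off the fixed points its values may depend
    on that choice, but it stays linear and multiplicative in [a], since [repr x] does not involve
    [a]. *)
Definition orbit_map (a : A) (x : coset_space H) : A := sigma (repr x) a.

Lemma orbit_map_coset a g :
  fixed_points rho a -> orbit_map a (coset H g) = sigma g a.
Proof.
move=> a_fix; have [_ sigmaM _ _] := sigma_rep.
(* The chosen representative is [g] times an element of [H], and this right factor acts first,
   fixing [a]. *)
have gH : (g^-1 * repr (coset H g))%g \in H.
  by have /esym/eqmodP := coset_repr (coset H g).
have := rhoE (exist (fun x => x \in H) _ gH) a; rewrite a_fix /= => aE.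
by rewrite /orbit_map -[repr _](mulVKg g) sigmaM -aE.
Qed.

Lemma equivariant_mapsE :
  equivariant_maps H sigma =
    [set K | exists2 a, fixed_points rho a &
               forall g, K (coset H g) = sigma g a].
Proof.
have [_ sigmaM _ _] := sigma_rep.
apply/seteqP; split=> [K K_eqv|K [a a_fix KE] g x].
- exists (K (coset H 1%g)) => [h|g].
    (* Equivariance turns the action of [h] on the value at the base point into the value at [hH],
       which is the base point again. *)
    rewrite rhoE -K_eqv coset_translateE mulg1; congr K.
    by apply/eqmodP; rewrite /= /left_coset_rel mulg1 gpredV (valP h).
  by rewrite -K_eqv coset_translateE mulg1.
- by rewrite -[x]coset_repr coset_translateE !KE sigmaM.
Qed.

Lemma equivariant_maps_image :
  equivariant_maps H sigma = orbit_map @` fixed_points rho.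
Proof.
rewrite equivariant_mapsE; apply/seteqP; split=> [K [a a_fix KE]|_ [a a_fix <-]].
- by exists a => //; apply/funext => x; rewrite -[x]coset_repr KE orbit_map_coset.
- by exists a => // g; exact: orbit_map_coset.
Qed.

(** The value at the base coset recovers [a]. *)
Lemma orbit_map_inj : set_inj (fixed_points rho) orbit_map.
Proof.
have [sigma1 _ _ _] := sigma_rep.
move=> a b /set_mem a_fix /set_mem b_fix /(congr1 (@^~ (coset H 1%g))).
by rewrite !orbit_map_coset // !sigma1.
Qed.

Lemma orbit_map_linear c a b :
  orbit_map (c *: a + b) = c *: orbit_map a + orbit_map b.
Proof. by have [_ _ lin _] := sigma_rep; apply/funext => x; exact: lin. Qed.

Lemma orbit_map_amul a b :
  orbit_map (amul a b) = amul (orbit_map a) (orbit_map b).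
Proof. by have [_ _ _ mul] := sigma_rep; apply/funext => x; exact: mul. Qed.

Lemma orbit_map_isomorphism :
  algebra_isomorphism (fixed_points rho) (equivariant_maps H sigma) orbit_map.
Proof.
rewrite equivariant_maps_image; apply: algebra_isomorphism_image.
- exact: fixed_points_subalgebra.
- exact: orbit_map_inj.
- by move=> c a b _ _; exact: orbit_map_linear.
- by move=> a b _ _; exact: orbit_map_amul.
Qed.

(** Evaluation at [1] inverts [cst] on automorphic maps; composing it with [orbit_map] links the two
    algebras through the fixed points. *)
Lemma automorphic_equivariant_isomorphism :
  algebra_isomorphism (automorphic_algebra rho) (equivariant_maps H sigma)
    (fun f => orbit_map (f 1%g)).
Proof.
have [[_ sub_aut] _ _ _] := cst_isomorphism.
have -> : equivariant_maps H sigma =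
    (fun f : G -> A => orbit_map (f 1%g)) @` automorphic_algebra rho.
  by rewrite automorphic_algebraE image_comp equivariant_maps_image.
apply: algebra_isomorphism_image => //.
(* Both maps are constant, so equality of their values at [1] suffices. *)
- rewrite automorphic_algebraE => _ _ /set_mem[a a_fix <-] /set_mem[b b_fix <-].
  by move=> /(orbit_map_inj (mem_set a_fix) (mem_set b_fix)) /= ->.
- by move=> c f g _ _; exact: orbit_map_linear.
- by move=> f g _ _; exact: orbit_map_amul.
Qed.

End EquivariantMaps.

End AutomorphicAlgebra.

Theorem theorem3p2 (R : realType) (k : scalars) (G : lieGroupType R)
    (H : groupClosed G) (H_closed : closed [set x : G | x \in H])
    (A : nonassocAlgType (scalar_field R k)) (rho : subgroup_type H -> A -> A)
    (rho_rep : algebra_representation rho) :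
  [/\ automorphic_algebra rho = [set cst a | a in fixed_points rho],
      algebra_isomorphism (fixed_points rho) (automorphic_algebra rho)
        (fun a => cst a)
    & forall sigma : G -> A -> A,
        algebra_representation sigma ->
        (forall (h : subgroup_type H) a, rho h a = sigma (\val h) a) ->
        [/\ equivariant_maps H sigma =
              [set K | exists2 a, fixed_points rho a &
                         forall g, K (coset H g) = sigma g a],
            exists2 psi : A -> coset_space H -> A,
              algebra_isomorphism (fixed_points rho) (equivariant_maps H sigma) psi
              & forall a g, fixed_points rho a -> psi a (coset H g) = sigma g a
          & exists2 theta : (G -> A) -> coset_space H -> A,
              algebra_isomorphism (automorphic_algebra rho)
                (equivariant_maps H sigma) theta
              & forall a g, fixed_points rho a ->
                  theta (cst a) (coset H g) = sigma g a]].
Proof.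
split=> [||sigma sigma_rep rhoE].
- exact: automorphic_algebraE.
- exact: cst_isomorphism.
split.
- exact: equivariant_mapsE.
- exists (orbit_map sigma); first exact: orbit_map_isomorphism.
  by move=> a g; exact: orbit_map_coset.
- exists (fun f => orbit_map sigma (f 1%g)).
    exact: automorphic_equivariant_isomorphism.
  by move=> a g; exact: orbit_map_coset.
Qed.
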